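(* Let $0<\alpha<1$ and $\lambda\ge1$. If $s<\min(1,\frac12+\frac12\nu_{c_1})$, then the bilinear estimate $$\|\partial_x(v_1v_2)\|_{X^{s,b-1}(\mathbb{T}_\lambda\times\mathbb{R})}\lesssim\|v_1\|_{X^{s,b}_\alpha(\mathbb{T}_\lambda\times\mathbb{R})}\|v_2\|_{X^{s,b}_\alpha(\mathbb{T}_\lambda\times\mathbb{R})}$$ fails for any $b\in\mathbb{R}$. Hence, the bilinear estimate $$\|\partial_x(v_1v_2)\|_{Z^s(\mathbb{T}_\lambda\times\mathbb{R})}\lesssim\|v_1\|_{Y^s_\alpha(\mathbb{T}_\lambda\times\mathbb{R})}\|v_2\|_{Y^s_\alpha(\mathbb{T}_\lambda\times\mathbb{R})}$$ also fails for $s<\min(1,\frac12+\frac12\nu_{c_1})$.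
   Context: $\mathbb{T}_\lambda=[0,2\pi\lambda)$ (periodic); $\langle\cdot\rangle=1+|\cdot|$. The spatial Fourier variable is $\xi\in\mathbb{Z}/\lambda$; $\widehat{\ }$ denotes the space-time Fourier transform; norms in $\xi$ use the measure $\frac1{2\pi\lambda}\times$ counting measure on $\mathbb{Z}/\lambda$. An estimate fails if, for the given $\alpha,\lambda,s,b$, there is no finite constant for which it holds for all $v_1,v_2$ in the indicated spaces. $\|u\|_{X^{s,b}}=\|\langle\xi\rangle^s\langle\tau-\xi^3\rangle^b\widehat u\|_{L^2_{\xi,\tau}}$, $\|v\|_{X^{s,b}_\alpha}=\|\langle\xi\rangle^s\langle\tau-\alpha\xi^3\rangle^b\widehat v\|_{L^2_{\xi,\tau}}$, $\|v\|_{Y^s_\alpha}=\|v\|_{X^{s,1/2}_\alpha}+\|\langle\xi\rangle^s\widehat v\|_{L^2_\xi L^1_\tau}$, $\|u\|_{Z^s}=\|u\|_{X^{s,-1/2}}+\|\langle\xi\rangle^s\langle\tau-\xi^3\rangle^{-1}\widehat u\|_{L^2_\xi L^1_\tau}$. $c_1=\frac12+\frac{\sqrt{-3+12\alpha^{-1}}}{6}$. A real number $\rho$ is of type $\nu>0$ if there is $K>0$ such that $|\rho-\frac mn|\ge K|n|^{-2-\nu}$ for all pairs of integers $(m,n)$, $n\ne0$; $\nu_\rho=\infty$ if $\rho\in\mathbb{Q}$, and $\nu_\rho=\inf\{\nu>0:\rho\text{ is of type }\nu\}$ (with $\inf\emptyset=\infty$) if $\rho\notin\mathbb{Q}$. 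*)

(* Defs.v *)
From HB Require Import structures.
From mathcomp Require Import all_boot all_order all_algebra.
From mathcomp Require Import complex.
From mathcomp Require Import all_classical all_reals all_analysis.

Set Implicit Arguments.
Unset Strict Implicit.
Unset Printing Implicit Defensive.

Import Order.TTheory GRing.Theory Num.Theory.
Import numFieldNormedType.Exports.

Local Open Scope classical_set_scope.
Local Open Scope ring_scope.

HB.instance Definition _ := isPointed.Build int 0.

HB.instance Definition _ := @isMeasurable.Build default_measure_display
  int discrete_measurable discrete_measurable0
  discrete_measurableC discrete_measurableU.

(* The integer k stands for the spatial frequency k / lam in Z / lam. *)
Definition xi (R : realType) (lam : R) (k : int) : R := k%:~R / lam.

(* The absolute value only supplies the sign: lam is always positive. *)
Definition freq_measure (R : realType) (lam : R) : set int -> \bar R :=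
  mscale (`|(2 * pi * lam)^-1|%:nng) counting.

HB.instance Definition _ (R : realType) (lam : R) :=
  Measure.on (freq_measure lam).

Lemma sigma_finite_freq_measure (R : realType) (lam : R) :
  sigma_finite [set: int] (freq_measure lam).
Proof.
exists (fun n => [set k : int | (`|k| <= n)%N]).
  by apply/esym/seteqP; split=> // k _; exists `|k|%N => /=.
move=> n; split => //; rewrite /freq_measure /mscale/= /counting asboolT.
  by rewrite -EFinM ltry.
apply: (@sub_finite_set _ _
  ((fun m : nat => Posz m) @` `I_n.+1 `|` (fun m : nat => - Posz m) @` `I_n.+1)).
  by move=> [m|m] /= mn; [left; exists m|right; exists m.+1; rewrite ?NegzE].
by rewrite finite_setU; split; apply: finite_image; exact: finite_II.
Qed.

HB.instance Definition _ (R : realType) (lam : R) :=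
  @isSigmaFinite.Build _ _ _ (freq_measure lam)
    (sigma_finite_freq_measure lam).

Definition spacetime_freq_measure (R : realType) (lam : R) :
    {measure set (int * measurableTypeR R) -> \bar R} :=
  (freq_measure lam \x (@lebesgue_measure R))%E.

(* A tempered distribution v on T_lam x R belonging to one of the spaces below
   is determined by its space-time Fourier transform, which is a measurable
   function with a finite weighted norm; conversely every such function is the
   Fourier transform of a tempered distribution.  Distributions are therefore
   represented by V = \hat v, where V k tau = \hat v (k / lam, tau) and
   \hat v (xi, tau) = \int_R \int_(T_lam) exp (- i (x xi + t tau)) v (x, t). *)
Definition spectrum (R : realType) := int -> R -> R[i].

Definition measurable_spectrum (R : realType) (V : spectrum R) : Prop :=
  forall k, measurable_fun [set: R] (fun tau => complex.Re (V k tau)) /\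
            measurable_fun [set: R] (fun tau => complex.Im (V k tau)).

Section norms.
Context {R : realType}.
Implicit Types (lam alpha s b : R) (V : spectrum R).

Definition bracket (x : R) : R := 1 + `|x|.

Definition L2xi_L2tau lam (f : int -> R -> R) : \bar R :=
  Lnorm (spacetime_freq_measure lam) 2%:E (fun p => (f p.1 p.2)%:E).

Definition L2xi_L1tau lam (f : int -> R -> R) : \bar R :=
  Lnorm (freq_measure lam) 2%:E
    (fun k => Lnorm (@lebesgue_measure R) 1%:E (fun tau => (f k tau)%:E)).

Definition Xalpha_norm alpha lam s b V : \bar R :=
  L2xi_L2tau lam (fun k tau => bracket (xi lam k) `^ s *
    bracket (tau - alpha * xi lam k ^+ 3) `^ b * Normc.normc (V k tau)).

Definition X_norm lam s b V : \bar R := Xalpha_norm 1 lam s b V.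

Definition Y_norm alpha lam s V : \bar R :=
  (Xalpha_norm alpha lam s 2^-1 V +
   L2xi_L1tau lam
     (fun k tau => (bracket (xi lam k) `^ s * Normc.normc (V k tau))%R))%E.

Definition Z_norm lam s V : \bar R :=
  (X_norm lam s (- 2^-1) V +
   L2xi_L1tau lam
     (fun k tau => (bracket (xi lam k) `^ s *
        bracket (tau - xi lam k ^+ 3) `^ (-1) * Normc.normc (V k tau))%R))%E.

Definition Xalpha_space alpha lam s b : set (spectrum R) :=
  [set V | measurable_spectrum V /\ (Xalpha_norm alpha lam s b V < +oo)%E].

Definition Y_space alpha lam s : set (spectrum R) :=
  [set V | measurable_spectrum V /\ (Y_norm alpha lam s V < +oo)%E].

End norms.

Section product.
Context {R : realType}.
Implicit Types (lam : R) (V : spectrum R).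

Definition complex_integral d (T : measurableType d)
    (mu : {measure set T -> \bar R}) (f : T -> R[i]) : R[i] :=
  Complex (\int[mu]_x complex.Re (f x)) (\int[mu]_x complex.Im (f x)).

(* The Fourier transform of the product of two distributions is the convolution
   of their Fourier transforms; the factor (2 pi)^-1 belongs to dtau, the
   corresponding factor (2 pi lam)^-1 is part of the measure on Z / lam. *)
Definition fourier_product lam V1 V2 : spectrum R := fun k tau =>
  (((2 * pi)^-1)%:C)%C * complex_integral (spacetime_freq_measure lam)
    (fun q => V1 q.1 q.2 * V2 (k - q.1) (tau - q.2)).

Definition product_defined lam V1 V2 : Prop :=
  forall k, {ae @lebesgue_measure R, forall tau,
    (spacetime_freq_measure lam).-integrable setT
      (fun q => (Normc.normc (V1 q.1 q.2 * V2 (k - q.1) (tau - q.2)))%:E)}.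

Definition fourier_dx lam V : spectrum R := fun k tau =>
  Complex 0 (xi lam k) * V k tau.

(* Products of distributions are only considered when they make sense; without
   this restriction the estimates could fail for lack of a product. *)
Definition bilinear_estimate lam (S : set (spectrum R))
    (normL normR : spectrum R -> \bar R) : Prop :=
  exists C : R, forall V1 V2, S V1 -> S V2 -> product_defined lam V1 V2 ->
    (normL (fourier_dx lam (fourier_product lam V1 V2)) <=
       C%:E * normR V1 * normR V2)%E.

End product.

Section irrationality.
Context {R : realType}.

Definition c1 (alpha : R) : R :=
  2^-1 + Num.sqrt (- 3 + 12 * alpha^-1) / 6.

Definition of_type (rho nu : R) : Prop :=
  0 < nu /\ exists2 K : R, 0 < K & forall m n : int, n != 0 ->
    K * `|n%:~R| `^ (- 2 - nu) <= `|rho - m%:~R / n%:~R|.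

Definition min_type (rho : R) : \bar R :=
  if `[< exists q : rat, rho = ratr q >] then +oo%E
  else ereal_inf (EFin @` [set nu | of_type rho nu]).

End irrationality.

(* Main.v *)
Require Import Defs.
From mathcomp Require Import all_boot all_order all_algebra.
From mathcomp Require Import complex.
From mathcomp Require Import all_classical all_reals all_analysis.
From mathcomp Require Import measurable_realfun.
From mathcomp Require Import ring lra.

Import Order.TTheory GRing.Theory Num.Theory.
Import numFieldNormedType.Exports.

Local Open Scope classical_set_scope.
Local Open Scope ring_scope.

(** The interaction of a wave at frequency xi1 with one at frequency xi2 into
    one at xi = xi1 + xi2 is governed by the resonance function
      H = xi^3 - alpha xi1^3 - alpha xi2^3,
    which factors as - 3 alpha xi^3 (xi1/xi - c1) (xi1/xi - (1 - c1)).  It is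
    small when the fraction m/n = xi1/xi approximates c1 well, and then the
    modulation weights cannot make up for the derivative.

    To see this, test the estimate on two boxes, i.e. indicators of a single
    frequency times a bounded interval of tau.  Placing both on the
    curves tau = alpha xi^3 puts the product at distance about |H| from the
    curve tau = xi^3; shifting one of them by H puts the product on that curve
    instead, at the price of a weight <H>^b.  The first choice costs
    <H>^(1 - b), so the better of the two costs at most <H>^(1/2), whatever b
    is.  The first choice with b = 1/2 also serves for the pair (Y, Z), because
    the L^1_tau part of the Y norm of such a box is comparable to the L^2_tau
    part, and Z dominates X^(s,-1/2).  Hence either estimate yields
      |xi| <xi>^s <= K <xi1>^s <xi2>^s <H>^(1/2)
    ([X_estimate_resonance], [YZ_estimate_resonance]).

    If m/n is close to c1 > 1, then xi1, xi2 and xi have comparable sizes, so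
      <xi>^(2 - 2 s) <= B (1 + |xi|^3 |m/n - c1|).
    As s < 1, the term 1 is negligible for large xi, and with
    sigma = max(s, 0) one gets, for all fractions,
      |c1 - m/n| >= kappa |n|^-(1 + 2 sigma)
    ([resonance_bound_approximation_exponent]).  Dirichlet's theorem forces
    1 + 2 sigma >= 2 ([approximation_exponent_ge2]), so that sigma = s, and
    then c1 is irrational of every type greater than 2 s - 1
    ([min_type_le]).  So the minimal type nu of c1 satisfies
    s >= 1/2 + nu/2, against the assumption. *)

(** * Monotonicity and indicators in Lebesgue norms *)

Section lebesgue_norms.
Local Open Scope ereal_scope.
Context d (T : measurableType d) (R : realType).
Variable mu : {measure set T -> \bar R}.

(** The integral of a nonnegative function is a supremum over the simple
    functions below it, so it is monotone even without measurability; this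
    spares a measurability proof for the convolution of two spectra. *)
Lemma ge0_le_integralT (f g : T -> \bar R) :
  (forall x, 0 <= f x) -> (forall x, f x <= g x) ->
  \int[mu]_x f x <= \int[mu]_x g x.
Proof.
move=> f0 fg; have g0 x : 0 <= g x by exact: le_trans (fg x).
rewrite !ge0_integralTE//; apply: le_ereal_sup => _ [h /= hf <-].
by exists h => // x; exact: le_trans (fg x).
Qed.

Lemma le_Lnorm (r : R) (f g : T -> \bar R) : (0 < r)%R ->
  (forall x, `|f x| <= `|g x|) -> 'N[mu]_r%:E[f] <= 'N[mu]_r%:E[g].
Proof.
move=> r0 fg; rewrite unlock.
have itv_ge0 (y : \bar R) : 0 <= y -> y \in `[0, +oo].
  by move=> y0; rewrite in_itv/= y0 leey.
have pow_ge0 (h : T -> \bar R) : 0 <= \int[mu]_x (`|h x| `^ r).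
  by apply: integral_ge0 => x _; exact: poweR_ge0.
apply: gt0_ler_poweR; rewrite ?invr_ge0 ?(ltW r0) ?itv_ge0//.
apply: ge0_le_integralT => x; first exact: poweR_ge0.
by apply: gt0_ler_poweR; rewrite ?(ltW r0) ?itv_ge0.
Qed.

Lemma Lnorm_cst_indic (r A : R) (S : set T) : (0 < r)%R -> (0 <= A)%R ->
  measurable S ->
  Lnorm mu r%:E (fun x => (A * \1_S x)%:E) = A%:E * mu S `^ r^-1.
Proof.
move=> r0 A0 mS; rewrite unlock.
have -> : (\int[mu]_x (`|(A * \1_S x)%:E| `^ r) =
    \int[mu]_x ((A `^ r)%:E * (\1_S x)%:E))%E.
  apply: eq_integral => x _; rewrite abse_EFin poweR_EFin -EFinM.
  rewrite normrM powRM// (ger0_norm A0) indicE; case: (x \in S) => /=.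
    by rewrite normr1 powR1.
  by rewrite normr0 powR0// gt_eqF.
rewrite ge0_integralZl_EFin ?powR_ge0//; last first.
  by apply/measurable_EFinP; exact: measurable_indic.
rewrite integral_indic// setIT poweRM// ?lee_fin ?powR_ge0//.
by rewrite poweR_EFin -powRrM mulfV ?gt_eqF// powRr1.
Qed.

End lebesgue_norms.

(** * Measures of boxes *)

Lemma lebesgue_measure_segment (R : realType) (a b : R) : a <= b ->
  (lebesgue_measure (`[a, b]%classic : set R) = (b - a)%:E)%E.
Proof.
rewrite le_eqVlt lebesgue_measure_itv/= lte_fin => /predU1P[->|->].
  by rewrite ltxx subrr.
by rewrite EFinB.
Qed.

Section measure_of_boxes.
Context {R : realType}.
Variable lam : R.
Hypothesis lam_gt0 : 0 < lam.

Let weight_gt0 : 0 < (2 * pi * lam)^-1.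
Proof. by rewrite invr_gt0 !mulr_gt0// pi_gt0. Qed.

Lemma freq_measure_set1 (k : int) :
  freq_measure lam [set k] = ((2 * pi * lam)^-1)%:E.
Proof.
transitivity (((2 * pi * lam)^-1)%:E * counting [set k])%E.
  by rewrite /freq_measure /mscale/= gtr0_norm.
by rewrite /counting asboolT// fset_set1 finmap.cardfs1 mule1.
Qed.

Lemma spacetime_freq_measure_box (k : int) (a b : R) : a <= b ->
  spacetime_freq_measure lam ([set k] `*` `[a, b]) =
  ((2 * pi * lam)^-1 * (b - a))%:E.
Proof.
move=> ab; transitivity (freq_measure lam [set k] *
    lebesgue_measure (`[a, b]%classic : set R))%E.
  exact: product_measure1E.
by rewrite freq_measure_set1 (lebesgue_measure_segment _ _ _ ab) EFinM.
Qed.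

Lemma measurable_box (k : int) (a b : R) :
  measurable ([set k] `*` `[a, b] : set (int * measurableTypeR R)).
Proof. by apply: measurableX. Qed.

End measure_of_boxes.

(** * Products of two boxes *)

Section box_spectra.
Context {R : realType}.
Variable lam : R.
Hypothesis lam_gt0 : 0 < lam.
Implicit Types (k : int) (a b t u : R).

(** Written with an indicator of a measurable rectangle, so that its norms are
    those of indicators. *)
Definition box k a b : spectrum R :=
  fun l tau => Complex (\1_([set k] `*` `[a, b]) (l, tau)) 0.

Lemma boxE k a b l tau :
  box k a b l tau = Complex (((l == k) && (a <= tau <= b))%:R) 0.
Proof.
rewrite /box indicE; congr (Complex _%:R _); congr nat_of_bool.
apply/idP/idP; rewrite inE/= in_itv/=.
  by move=> [-> ->]; rewrite eqxx.
by move=> /andP[/eqP].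
Qed.

Lemma normc_box k a b l tau :
  Normc.normc (box k a b l tau) = \1_([set k] `*` `[a, b]) (l, tau).
Proof. by rewrite /= expr0n/= addr0 sqrtr_sqr ger0_norm. Qed.

Lemma measurable_box_spectrum k a b : measurable_spectrum (box k a b).
Proof.
move=> l; split; last exact: measurable_cst.
have -> : (fun tau => complex.Re (box k a b l tau)) =
    (fun tau => (l == k)%:R * \1_(`[a, b]%classic) tau) :> (R -> R).
  apply/funext => tau; rewrite boxE/= indicE mem_setE in_itv/=.
  by rewrite -natrM mulnb.
by apply: measurable_funM => //; exact: measurable_indic.
Qed.

(** The integrand of a convolution of boxes is again an indicator, supported in
    the first box; this makes every convolution integral converge. *)
Lemma box_mulE k1 k2 a b c d k tau : exists S : set (int * measurableTypeR R),
  [/\ measurable S, S `<=` [set k1] `*` `[a, b] & forall q,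
    box k1 a b q.1 q.2 * box k2 c d (k - q.1) (tau - q.2) =
      Complex (\1_S q) 0].
Proof.
have mulC0 (x y : R) : Complex x 0 * Complex y 0 = Complex (x * y) 0.
  by apply/eqP; rewrite eq_complex/= !mulr0 !mul0r subr0 addr0 !eqxx.
exists (if k == k1 + k2 then [set k1] `*` (`[a, b] `&` `[tau - d, tau - c])
        else set0); split.
- by case: ifP => // _; apply: measurableX => //; exact: measurableI.
- by case: ifP => // _ q [? []].
move=> [l t]; rewrite !boxE/= mulC0 -natrM mulnb; congr (Complex _ _).
rewrite indicE; congr (_%:R); congr nat_of_bool; case: ifPn => [/eqP ->|kk].
  apply/idP/idP; rewrite inE/= !in_itv/=.
    move=> /andP[/andP[/eqP -> ab] /andP[_ cd]]; split=> //; split=> //.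
    by apply/andP; split; move: cd => /andP[]; lra.
  move=> [-> [-> cd]]; rewrite eqxx/= addrAC subrr add0r eqxx/=.
  by apply/andP; split; move: cd => /andP[]; lra.
rewrite in_set0; apply/negbTE; apply: contra kk.
by move=> /andP[/andP[/eqP -> _] /andP[/eqP <- _]]; rewrite addrC subrK.
Qed.

Lemma product_defined_box k1 k2 a b c d : a <= b ->
  product_defined lam (box k1 a b) (box k2 c d).
Proof.
move=> ab k; apply/nearW => tau.
have [S [mS Ssub SE]] := box_mulE k1 k2 a b c d k tau.
under eq_fun do rewrite SE /= expr0n/= addr0 sqrtr_sqr ger0_norm//.
apply/integrableP; split.
  by apply/measurable_EFinP; exact: measurable_indic.
under eq_integral do rewrite abse_EFin ger0_norm//.
rewrite integral_indic// setIT.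
apply: (@le_lt_trans _ _
  (spacetime_freq_measure lam ([set k1] `*` `[a, b]))).
  by apply: le_measure; rewrite ?inE//; exact: measurable_box.
by rewrite spacetime_freq_measure_box// ltry.
Qed.

(** With the second box twice as long as the first, the reflected and translated
    second box covers the first one for tau in a unit interval, where the
    convolution is thus the integral of the first box alone. *)
Lemma fourier_product_box k1 k2 t u tau : t + u <= tau <= t + u + 1 ->
  fourier_product lam (box k1 t (t + 1)) (box k2 (u - 1) (u + 1)) (k1 + k2) tau
  = Complex ((2 * pi)^-1 * (2 * pi * lam)^-1) 0.
Proof.
move=> /andP[tau1 tau2]; rewrite /fourier_product /complex_integral.
have E q : box k1 t (t + 1) q.1 q.2 *
    box k2 (u - 1) (u + 1) (k1 + k2 - q.1) (tau - q.2) =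
    box k1 t (t + 1) q.1 q.2.
  have [] := boolP ((q.1 == k1) && (t <= q.2 <= t + 1)); last first.
    by rewrite boxE => /negbTE ->; rewrite mul0r.
  move=> /andP[/eqP -> /andP[q1 q2]].
  rewrite [X in _ * X]boxE addrAC subrr add0r eqxx/=.
  suff -> : (u - 1 <= tau - q.2 <= u + 1) by rewrite mulr1.
  by apply/andP; split; lra.
under eq_Rintegral do rewrite E.
under [X in Complex _ X]eq_Rintegral do rewrite E.
have IE : (\int[spacetime_freq_measure lam]_q
    (complex.Re (box k1 t (t + 1) q.1 q.2))%:E)%E = ((2 * pi * lam)^-1)%:E.
  transitivity (\int[spacetime_freq_measure lam]_q
      (\1_([set k1] `*` `[t, t + 1]) q)%:E)%E.
    by apply: eq_integral => -[].
  rewrite integral_indic//; last exact: measurable_box.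
  rewrite setIT spacetime_freq_measure_box ?lerDl//.
  by rewrite [t + 1]addrC addrK mulr1.
rewrite /Rintegral IE integral0/=.
by apply/eqP; rewrite eq_complex/= !mulr0 !mul0r subr0 addr0 !eqxx.
Qed.

Lemma normc_fourier_dx (V : spectrum R) k tau (x : R) : 0 <= x ->
  V k tau = Complex x 0 ->
  Normc.normc (fourier_dx lam V k tau) = `|xi lam k| * x.
Proof.
move=> x0 Vx; rewrite /fourier_dx Normc.normcM Vx /=.
by rewrite !expr0n/= addr0 add0r !sqrtr_sqr (ger0_norm x0).
Qed.

End box_spectra.

(** * Weights *)

Section brackets.
Context {R : realType}.
Implicit Types x y p D : R.

Lemma bracket_ge1 x : 1 <= bracket x.
Proof. by rewrite /bracket lerDl. Qed.

Lemma bracket_gt0 x : 0 < bracket x.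
Proof. exact: lt_le_trans (bracket_ge1 x). Qed.

Lemma bracketN x : bracket (- x) = bracket x.
Proof. by rewrite /bracket normrN. Qed.

(** The absolute value of the exponent lets one statement serve weights of
    either sign: for p < 0 the second comparison is used, inverted. *)
Lemma le_powR_comparable D x y p : 0 < D -> 0 < x -> 0 < y ->
  x <= D * y -> y <= D * x -> x `^ p <= D `^ `|p| * y `^ p.
Proof.
move=> D0 x0 y0 xy yx; have [p0|p0] := leP 0 p.
  rewrite (ger0_norm p0) -powRM ?(ltW D0) ?(ltW y0)//.
  by apply: ge0_ler_powR => //; rewrite nnegrE ?mulr_ge0 // ltW.
have xp : 0 < x `^ (- p) by rewrite powR_gt0.
have yp : 0 < y `^ (- p) by rewrite powR_gt0.
rewrite -[p in x `^ p]opprK -[p in y `^ p]opprK !(powRN _ (- p)).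
rewrite ler_pdivlMr// mulrC ler_pdivrMr//.
rewrite (ltr0_norm p0) -powRM ?(ltW D0) ?(ltW x0)//.
by apply: ge0_ler_powR; rewrite ?nnegrE ?mulr_ge0 ?oppr_ge0 // ltW.
Qed.

Lemma le_bracket_near x y : `|x - y| <= 1 -> bracket x <= 2 * bracket y.
Proof.
move=> xy; have := ler_normD (x - y) y; rewrite subrK /bracket.
by have := normr_ge0 y; lra.
Qed.

Lemma le_bracket_powR_near x y p : `|x - y| <= 1 ->
  bracket x `^ p <= 2 `^ `|p| * bracket y `^ p.
Proof.
move=> xy; apply: le_powR_comparable; rewrite ?bracket_gt0 ?le_bracket_near//.
by rewrite distrC.
Qed.

(** Frequencies in a fixed ratio have comparable weights; the two conditions on
    D bound the ratio from above and away from 0. *)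
Lemma le_bracket_powR_scale (D c x p : R) :
  1 <= D -> `|c| <= D -> 1 <= D * `|c| ->
  bracket (c * x) `^ p <= D `^ `|p| * bracket x `^ p.
Proof.
move=> D1 cD Dc; have x0 := normr_ge0 x.
apply: le_powR_comparable; rewrite ?bracket_gt0//; first exact: lt_le_trans D1.
  rewrite /bracket normrM mulrDr mulr1; apply: lerD => //.
  exact: ler_wpM2r.
rewrite /bracket normrM mulrDr mulr1; apply: lerD => //.
by rewrite mulrA -[leLHS]mul1r; exact: ler_wpM2r.
Qed.

End brackets.

(** * Norms of boxes *)

Section norms_of_boxes.
Context {R : realType}.
Variable lam : R.
Hypothesis lam_gt0 : 0 < lam.
Implicit Types (k : int) (alpha s b t u c : R) (V : spectrum R).

Local Notation weight := ((2 * pi * lam)^-1).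

Let weight_gt0 : 0 < weight.
Proof. by rewrite invr_gt0 !mulr_gt0// pi_gt0. Qed.

(** The modulation weight varies by a bounded factor over an interval of unit
    radius, so it may be frozen at the centre c. *)
Lemma Xalpha_norm_box_le alpha s b k t u c : t <= u ->
  (forall tau, t <= tau <= u -> `|tau - c| <= 1) ->
  (Xalpha_norm alpha lam s b (box k t u) <=
   (bracket (xi lam k) `^ s *
     (2 `^ `|b| * bracket (c - alpha * xi lam k ^+ 3) `^ b) *
     (weight * (u - t)) `^ 2^-1)%:E)%E.
Proof.
move=> tu near_c; rewrite EFinM -poweR_EFin -(spacetime_freq_measure_box _ lam_gt0 k)//.
rewrite -Lnorm_cst_indic ?mulr_ge0 ?powR_ge0//; last exact: measurable_box.
apply: le_Lnorm => // -[l tau]; rewrite !abse_EFin lee_fin normc_box.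
rewrite !normrM !(ger0_norm (powR_ge0 _ _)) ger0_norm// indicE.
have [|_] := boolP ((l, tau) \in _); last by rewrite !mulr0.
rewrite !mulr1 inE/= in_itv/= => -[-> /near_c tauc].
apply: ler_wpM2l; first exact: powR_ge0.
by apply: le_bracket_powR_near; rewrite opprB addrA subrK.
Qed.

Lemma L2xi_L1tau_box_le s k t u : t <= u ->
  (L2xi_L1tau lam
     (fun l tau => (bracket (xi lam l) `^ s * Normc.normc (box k t u l tau))%R)
   <= (bracket (xi lam k) `^ s * (u - t) * weight `^ 2^-1)%:E)%E.
Proof.
move=> tu; rewrite EFinM -poweR_EFin -(freq_measure_set1 _ lam_gt0 k).
rewrite -Lnorm_cst_indic ?mulr_ge0 ?powR_ge0 ?subr_ge0//.
apply: le_Lnorm => // l.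
rewrite gee0_abs ?Lnorm_ge0// abse_EFin.
have -> : (fun tau => (bracket (xi lam l) `^ s *
      Normc.normc (box k t u l tau))%:E) =
    (fun tau => (bracket (xi lam l) `^ s * (l == k)%:R *
      \1_(`[t, u]%classic) tau)%:E) :> (R -> \bar R).
  apply/funext => tau; rewrite -mulrA; congr (_ * _)%:E.
  rewrite boxE/= expr0n/= addr0 sqrtr_sqr ger0_norm//.
  by rewrite indicE mem_setE in_itv/= -natrM mulnb.
rewrite Lnorm_cst_indic ?mulr_ge0 ?powR_ge0//.
rewrite invr1 poweRe1//.
rewrite [X in (_ * X)%E](lebesgue_measure_segment _ _ _ tu : _ = _).
rewrite indicE (_ : (l \in [set k]) = (l == k)); last first.
  by apply/idP/eqP; rewrite inE.
rewrite -EFinM lee_fin; case: eqVneq => [->|_].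
  by rewrite !mulr1 ler_norm.
by rewrite !(mulr0, mul0r).
Qed.

Lemma Xalpha_norm_ge alpha s b k t A V : 0 <= A ->
  (forall tau, t <= tau <= t + 1 -> A <= Normc.normc (V k tau)) ->
  ((bracket (xi lam k) `^ s *
     ((2 `^ `|b|)^-1 * bracket (t - alpha * xi lam k ^+ 3) `^ b) * A *
     weight `^ 2^-1)%:E <= Xalpha_norm alpha lam s b V)%E.
Proof.
move=> A0 VA.
have -> : weight = weight * (t + 1 - t) by rewrite [t + 1]addrC addrK mulr1.
rewrite EFinM -poweR_EFin -(spacetime_freq_measure_box _ lam_gt0 k) ?lerDl//.
rewrite -Lnorm_cst_indic ?mulr_ge0 ?powR_ge0 ?invr_ge0 ?powR_ge0//; last first.
  exact: measurable_box.
apply: le_Lnorm => // -[l tau]; rewrite !abse_EFin lee_fin/= indicE.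
have [|_] := boolP ((l, tau) \in _); last by rewrite mulr0 normr0.
rewrite !mulr1 inE/= in_itv/= => -[-> tau_t].
have V0 : 0 <= Normc.normc (V k tau) by exact: le_trans (VA _ tau_t).
rewrite !normrM !(ger0_norm (powR_ge0 _ _)) (ger0_norm A0) (ger0_norm V0).
rewrite ger0_norm ?invr_ge0 ?powR_ge0//.
apply: ler_pM => //; rewrite ?mulr_ge0 ?invr_ge0 ?powR_ge0//; last exact: VA.
apply: ler_wpM2l; first exact: powR_ge0.
rewrite mulrC ler_pdivrMr ?powR_gt0// [leRHS]mulrC.
apply: le_bracket_powR_near; rewrite opprB addrA subrK.
by rewrite ler_norml; apply/andP; split; move: tau_t => /andP[]; lra.
Qed.

End norms_of_boxes.

(** * What the bilinear estimates imply *)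

Section testing_on_boxes.
Context {R : realType}.
Variables (alpha lam s : R).
Hypothesis lam_gt0 : 0 < lam.
Implicit Types (k : int) (b t u C A : R).

Local Notation weight := ((2 * pi * lam)^-1).

Let weight_gt0 : 0 < weight.
Proof. by rewrite invr_gt0 !mulr_gt0// pi_gt0. Qed.

Definition resonance k1 k2 : R :=
  xi lam (k1 + k2) ^+ 3 - alpha * xi lam k1 ^+ 3 - alpha * xi lam k2 ^+ 3.

(** The necessary condition that both estimates share; it depends neither on b
    nor on the choice of the function spaces. *)
Definition resonance_bound (K : R) := forall k1 k2,
  `|xi lam (k1 + k2)| * bracket (xi lam (k1 + k2)) `^ s <=
  K * (bracket (xi lam k1) `^ s * bracket (xi lam k2) `^ s) *
    bracket (resonance k1 k2) `^ 2^-1.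

(** The common part of both estimates: all that is needed of the left-hand norm
    is that it dominates some X^(s,b) norm. *)
Lemma bilinear_estimate_boxes (S : set (spectrum R))
    (normL normR : spectrum R -> \bar R) b :
  bilinear_estimate lam S normL normR ->
  (forall V, X_norm lam s b V <= normL V)%E ->
  (forall V, 0 <= normR V)%E ->
  exists2 K : R, 0 <= K & forall k1 k2 t u A1 A2,
    S (box k1 t (t + 1)) -> S (box k2 (u - 1) (u + 1)) ->
    (normR (box k1 t (t + 1)) <= A1%:E)%E ->
    (normR (box k2 (u - 1) (u + 1)) <= A2%:E)%E ->
    `|xi lam (k1 + k2)| * bracket (xi lam (k1 + k2)) `^ s *
      bracket (t + u - xi lam (k1 + k2) ^+ 3) `^ b <= K * A1 * A2.
Proof.
move=> [C estimate] leL normR0.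
(* The product of all constants in the lower bound for the product. *)
pose c := (2 `^ `|b|)^-1 * ((2 * pi)^-1 * weight) * weight `^ 2^-1.
have c_gt0 : 0 < c.
  by rewrite !mulr_gt0 ?invr_gt0 ?powR_gt0 ?mulr_gt0 ?pi_gt0.
exists (`|C| / c); first by rewrite divr_ge0 ?(ltW c_gt0).
move=> k1 k2 t u A1 A2 S1 S2 norm1 norm2.
have A1_ge0 : 0 <= A1 by rewrite -lee_fin; exact: le_trans norm1.
have A2_ge0 : 0 <= A2 by rewrite -lee_fin; exact: le_trans norm2.
set V := fourier_dx lam
  (fourier_product lam (box k1 t (t + 1)) (box k2 (u - 1) (u + 1))).
have VE tau : t + u <= tau <= t + u + 1 ->
    Normc.normc (V (k1 + k2) tau) =
    `|xi lam (k1 + k2)| * ((2 * pi)^-1 * weight).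
  move=> tau_tu; apply: normc_fourier_dx.
    by rewrite mulr_ge0 ?invr_ge0 ?mulr_ge0 ?(ltW lam_gt0) ?(ltW (pi_gt0 R)).
  exact: fourier_product_box.
have norm_le : (normL V <= (`|C| * A1 * A2)%:E)%E.
  apply: le_trans (estimate _ _ S1 S2 _) _.
    by apply: product_defined_box; rewrite ?lerDl.
  apply: (@le_trans _ _ (`|C|%:E * normR (box k1 t (t + 1)) *
      normR (box k2 (u - 1) (u + 1)))%E).
    by do 2! apply: lee_wpmul2r => //; rewrite lee_fin ler_norm.
  rewrite !EFinM; apply: lee_pmul => //; first by rewrite mule_ge0// lee_fin.
  by apply: lee_wpmul2l; rewrite // lee_fin.
have lower := Xalpha_norm_ge lam lam_gt0 1 s b (k1 + k2) (t + u)
  (`|xi lam (k1 + k2)| * ((2 * pi)^-1 * weight)) V.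
have {lower}/lower : 0 <= `|xi lam (k1 + k2)| * ((2 * pi)^-1 * weight).
  by rewrite !mulr_ge0 ?invr_ge0 ?mulr_ge0 ?(ltW lam_gt0) ?(ltW (pi_gt0 R)).
have VE_ge tau : t + u <= tau <= t + u + 1 ->
    `|xi lam (k1 + k2)| * ((2 * pi)^-1 * weight) <=
    Normc.normc (V (k1 + k2) tau) by move=> /VE ->.
move=> /(_ VE_ge) /le_trans /(_ (leL V)) /le_trans /(_ norm_le).
rewrite lee_fin mul1r => lower.
have -> : `|C| / c * A1 * A2 = `|C| * A1 * A2 / c by ring.
rewrite ler_pdivlMr//; apply: le_trans lower.
by rewrite /c le_eqVlt; apply/orP; left; apply/eqP; ring.
Qed.

Lemma Xalpha_norm_ge0 b V : (0 <= Xalpha_norm alpha lam s b V)%E.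
Proof. exact: Lnorm_ge0. Qed.

Lemma X_estimate_boxes b :
  bilinear_estimate lam (Xalpha_space alpha lam s b)
    (X_norm lam s (b - 1)) (Xalpha_norm alpha lam s b) ->
  exists2 K : R, 0 <= K & forall k1 k2 t u,
    `|xi lam (k1 + k2)| * bracket (xi lam (k1 + k2)) `^ s *
      bracket (t + u - xi lam (k1 + k2) ^+ 3) `^ (b - 1) <=
    K * (bracket (xi lam k1) `^ s * bracket (xi lam k2) `^ s) *
      (bracket (t - alpha * xi lam k1 ^+ 3) `^ b *
       bracket (u - alpha * xi lam k2 ^+ 3) `^ b).
Proof.
move=> /bilinear_estimate_boxes /(_ (fun V => lexx _)).
move=> /(_ (fun V => Xalpha_norm_ge0 b V)) [K K0 test].
exists (K * (2 `^ `|b| * weight `^ 2^-1) *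
            (2 `^ `|b| * (weight * 2) `^ 2^-1)).
  by rewrite !mulr_ge0 ?powR_ge0.
move=> k1 k2 t u.
have norm1 := @Xalpha_norm_box_le R lam lam_gt0 alpha s b k1 t (t + 1) t.
have {}norm1 := norm1 (ltac:(by rewrite lerDl)).
have norm2 := @Xalpha_norm_box_le R lam lam_gt0 alpha s b k2 (u - 1) (u + 1) u.
have {}norm2 := norm2 (ltac:(lra)).
have near1 tau : t <= tau <= t + 1 -> `|tau - t| <= 1.
  by move=> /andP[? ?]; rewrite ler_norml; apply/andP; split; lra.
have near2 tau : u - 1 <= tau <= u + 1 -> `|tau - u| <= 1.
  by move=> /andP[? ?]; rewrite ler_norml; apply/andP; split; lra.
move: norm1 norm2 => /(_ near1) norm1 /(_ near2) norm2.
have := test k1 k2 t u _ _ _ _ norm1 norm2.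
have in_space k a c A : (Xalpha_norm alpha lam s b (box k a c) <= A%:E)%E ->
    Xalpha_space alpha lam s b (box k a c).
  move=> normA; split; first exact: measurable_box_spectrum.
  exact: le_lt_trans normA (ltry _).
move=> /(_ (in_space _ _ _ _ norm1) (in_space _ _ _ _ norm2)) /le_trans; apply.
rewrite [t + 1]addrC addrK mulr1 (_ : u + 1 - (u - 1) = 2); last by ring.
by rewrite le_eqVlt; apply/orP; left; apply/eqP; ring.
Qed.

(** The box of frequency k1 sits on the curve tau = alpha xi^3.  For b >= 1/2
    the other one does too, which leaves the weight <H>^(b - 1) on the product;
    for b < 1/2 it is moved by H, which puts the product on tau = xi^3 and
    leaves <H>^b on the right. *)
Lemma X_estimate_resonance b :
  bilinear_estimate lam (Xalpha_space alpha lam s b)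
    (X_norm lam s (b - 1)) (Xalpha_norm alpha lam s b) ->
  exists2 K : R, 0 <= K & resonance_bound K.
Proof.
move=> /X_estimate_boxes[K K0 test]; exists K => // k1 k2.
have bracket0 : bracket (0 : R) = 1 by rewrite /bracket normr0 addr0.
set H := resonance k1 k2.
have H1 := bracket_ge1 H; have H0 := bracket_gt0 H.
have [b_ge|b_lt] := leP 2^-1 b.
  have := test k1 k2 (alpha * xi lam k1 ^+ 3) (alpha * xi lam k2 ^+ 3).
  rewrite !subrr bracket0 powR1 !mulr1.
  have -> : alpha * xi lam k1 ^+ 3 + alpha * xi lam k2 ^+ 3 -
      xi lam (k1 + k2) ^+ 3 = - H by rewrite /H /resonance; ring.
  rewrite bracketN => le_K.
  have Hpow : bracket H `^ (b - 1) * bracket H `^ (1 - b) = 1.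
    rewrite -powRD ?(gt_eqF H0) ?implybT//.
    by rewrite (_ : b - 1 + (1 - b) = 0) ?powRr0//; ring.
  rewrite -[leLHS]mulr1 -[X in _ * X <= _]Hpow [leLHS]mulrA.
  apply: ler_pM; rewrite ?mulr_ge0 ?powR_ge0//.
  by apply: ler_powR => //; lra.
have := test k1 k2 (alpha * xi lam k1 ^+ 3) (alpha * xi lam k2 ^+ 3 + H).
rewrite subrr bracket0 powR1 mul1r [_ + H]addrC addrK.
have -> : alpha * xi lam k1 ^+ 3 + (H + alpha * xi lam k2 ^+ 3) -
    xi lam (k1 + k2) ^+ 3 = 0 by rewrite /H /resonance; ring.
rewrite bracket0 powR1 mulr1 => /le_trans; apply.
apply: ler_wpM2l; first by rewrite !mulr_ge0 ?powR_ge0.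
by apply: ler_powR => //; exact: ltW.
Qed.

(** Boxes lying on the curve tau = alpha xi^3 see no modulation weight, so their
    L^2_tau and L^1_tau norms are both of order <xi>^s. *)
Lemma YZ_estimate_resonance :
  bilinear_estimate lam (Y_space alpha lam s)
    (Z_norm lam s) (Y_norm alpha lam s) ->
  exists2 K : R, 0 <= K & resonance_bound K.
Proof.
have leZ V : (X_norm lam s (- 2^-1) V <= Z_norm lam s V)%E.
  by rewrite leeDl// Lnorm_ge0.
have Y_ge0 V : (0 <= Y_norm alpha lam s V)%E.
  by rewrite adde_ge0// Lnorm_ge0.
move=> /bilinear_estimate_boxes /(_ leZ Y_ge0)[K K0 test].
pose M : R := 2 `^ `|2^-1| * (weight * 2) `^ 2^-1 + 2 * weight `^ 2^-1.
have norm_box k t u : t <= u <= t + 2 ->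
    (forall tau, t <= tau <= u -> `|tau - alpha * xi lam k ^+ 3| <= 1) ->
    (Y_norm alpha lam s (box k t u) <= (bracket (xi lam k) `^ s * M)%:E)%E.
  move=> /andP[tu ut] near_tu.
  apply: le_trans (leeD (Xalpha_norm_box_le _ lam_gt0 _ _ _ _ _ _ _ tu near_tu)
    (L2xi_L1tau_box_le _ lam_gt0 _ _ _ _ tu)) _.
  rewrite subrr /bracket normr0 addr0 powR1 mulr1 -EFinD lee_fin.
  rewrite -[X in X + _]mulrA -[X in _ + X]mulrA -mulrDr.
  apply: ler_wpM2l; first exact: powR_ge0.
  apply: lerD.
    apply: ler_wpM2l; first exact: powR_ge0.
    apply: ge0_ler_powR; rewrite ?nnegrE ?mulr_ge0 ?subr_ge0 ?(ltW weight_gt0)//.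
    by apply: ler_wpM2l; [exact: ltW|lra].
  by apply: ler_wpM2r; [exact: powR_ge0|lra].
have in_Y k t u A : (Y_norm alpha lam s (box k t u) <= A%:E)%E ->
    Y_space alpha lam s (box k t u).
  move=> normA; split; first exact: measurable_box_spectrum.
  exact: le_lt_trans normA (ltry _).
exists (K * M * M); first by rewrite !mulr_ge0 ?addr_ge0 ?mulr_ge0 ?powR_ge0.
move=> k1 k2; set H := resonance k1 k2.
pose t := alpha * xi lam k1 ^+ 3; pose u := alpha * xi lam k2 ^+ 3.
have norm1 : (Y_norm alpha lam s (box k1 t (t + 1)) <=
    (bracket (xi lam k1) `^ s * M)%:E)%E.
  apply: norm_box => [|tau /andP[? ?]]; first by apply/andP; split; lra.
  by rewrite ler_norml; apply/andP; split; rewrite -/t; lra.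
have norm2 : (Y_norm alpha lam s (box k2 (u - 1) (u + 1)) <=
    (bracket (xi lam k2) `^ s * M)%:E)%E.
  apply: norm_box => [|tau /andP[? ?]]; first by apply/andP; split; lra.
  by rewrite ler_norml; apply/andP; split; rewrite -/u; lra.
have := test k1 k2 t u _ _ (in_Y _ _ _ _ norm1) (in_Y _ _ _ _ norm2) norm1 norm2.
have -> : t + u - xi lam (k1 + k2) ^+ 3 = - H.
  by rewrite /H /resonance /t /u; ring.
rewrite bracketN powRN ler_pdivrMr ?powR_gt0 ?bracket_gt0// => /le_trans; apply.
by rewrite le_eqVlt; apply/orP; left; apply/eqP; ring.
Qed.

End testing_on_boxes.

(** * Diophantine approximation *)

Section diophantine.
Context {R : realType}.
Implicit Types (x rho kappa sigma : R).

Definition approximation_exponent rho (p kappa : R) := forall m n : int,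
  n != 0 -> kappa * `|n%:~R| `^ (- p) <= `|rho - m%:~R / n%:~R|.

(** Pigeonhole: among the N + 1 multiples i x, 0 <= i <= N, two have fractional
    parts in the same interval of length 1/N. *)
Lemma dirichlet_approximation x (N : nat) : (0 < N)%N ->
  exists (m : int) (n : nat),
    [/\ (0 < n)%N, (n <= N)%N & `|n%:R * x - m%:~R| <= N%:R^-1].
Proof.
move=> N0; have NR0 : 0 < N%:R :> R by rewrite ltr0n.
pose frac (i : nat) := i%:R * x - (Num.floor (i%:R * x))%:~R.
have frac_itv i : 0 <= frac i < 1.
  have := floor_itv (i%:R * x); rewrite intrD /frac => /andP[? ?].
  by apply/andP; split; lra.
have cell_lt i : (Num.trunc (N%:R * frac i) < N)%N.
  have /andP[f0 f1] := frac_itv i.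
  by rewrite truncn_lt_nat ?mulr_ge0 ?(ltW NR0)// -[ltRHS]mulr1 ltr_pM2l.
pose cell (i : 'I_N.+1) := Ordinal (cell_lt i).
have /injectivePn[i [j ij cell_ij]] : ~~ injectiveb cell.
  apply/injectiveP => /leq_card; by rewrite !card_ord ltnn.
wlog lt_ij : i j ij cell_ij / (i < j)%N.
  move=> wlog_ij; have [lt_ij|lt_ji|eq_ij] := ltngtP i j.
  - exact: (wlog_ij i j).
  - by apply: (wlog_ij j i); rewrite // eq_sym.
  - by move: ij; rewrite (val_inj eq_ij) eqxx.
exists (Num.floor (j%:R * x) - Num.floor (i%:R * x)), (j - i)%N; split.
- by rewrite subn_gt0.
- by rewrite (leq_trans (leq_subr _ _))// -ltnS.
have -> : (j - i)%:R * x -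
    (Num.floor (j%:R * x) - Num.floor (i%:R * x))%:~R = frac j - frac i.
  by rewrite natrB ?(ltnW lt_ij)// intrB /frac; ring.
have /(congr1 val)/= cellE := cell_ij.
have /andP[i0 _] := frac_itv i; have /andP[j0 _] := frac_itv j.
have := truncn_itv (mulr_ge0 (ltW NR0) i0).
have := truncn_itv (mulr_ge0 (ltW NR0) j0).
rewrite cellE -(natr1 (Num.trunc (N%:R * frac j))) => /andP[? ?] /andP[? ?].
rewrite -(ler_pM2l NR0) mulfV ?gt_eqF// -[X in X * _](gtr0_norm NR0) -normrM.
by rewrite mulrBr ler_norml; apply/andP; split; lra.
Qed.

Lemma exists_nat_powR_ge (p B : R) : 0 < p ->
  exists2 N : nat, (0 < N)%N & B <= N%:R `^ p.
Proof.
move=> p0; exists (Num.trunc (`|B| `^ p^-1)).+1 => //.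
apply: le_trans (ler_norm B) _.
set y := `|B| `^ p^-1; have -> : `|B| = y `^ p.
  by rewrite -powRrM mulVf ?powRr1// gt_eqF.
apply: ge0_ler_powR; rewrite ?nnegrE ?powR_ge0 ?(ltW p0)//.
exact: ltW (truncnS_gt _).
Qed.

(** Dirichlet's theorem with denominators up to N gives kappa N <= N^(p - 1),
    which for p < 2 fails for large N. *)
Lemma approximation_exponent_ge2 rho p kappa : 0 < kappa -> 1 <= p ->
  approximation_exponent rho p kappa -> 2 <= p.
Proof.
move=> kappa0 p1 approx; rewrite leNgt; apply/negP => p2.
have p2' : 0 < 2 - p by rewrite subr_gt0.
have [N N0 Nlarge] := exists_nat_powR_ge (2 - p) (2 / kappa) p2'.
have [m [n [n0 nN approx_mn]]] := dirichlet_approximation rho N N0.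
have nR0 : 0 < n%:R :> R by rewrite ltr0n.
have NR0 : 0 < N%:R :> R by rewrite ltr0n.
have := approx m n%:Z; rewrite eqz_nat -lt0n => /(_ n0).
have -> : `|rho - m%:~R / n%:~R| = `|n%:R * rho - m%:~R| / n%:R.
  have -> : rho - m%:~R / n%:~R = (n%:R * rho - m%:~R) / n%:R.
    by rewrite -pmulrn; field; rewrite gt_eqF.
  by rewrite normf_div (gtr0_norm nR0).
rewrite normr_nat powRN ler_pdivlMr// -mulrA => lower.
have npow : n%:R `^ p = n%:R `^ (p - 1) * n%:R :> R.
  rewrite -[X in _ * X]powRr1 ?(ltW nR0)// -powRD ?subrK//.
  by rewrite (gt_eqF nR0) implybT.
move: lower; rewrite npow invfM -mulrA mulVf ?gt_eqF// mulr1 => lower.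
have {lower approx_mn}le_n : kappa * N%:R <= n%:R `^ (p - 1).
  have := le_trans lower approx_mn.
  rewrite ler_pdivrMr ?powR_gt0// => le1.
  by rewrite -ler_pdivlMr// mulrC.
have le_N : n%:R `^ (p - 1) <= N%:R `^ (p - 1) :> R.
  by apply: ge0_ler_powR; rewrite ?nnegrE ?subr_ge0 ?ler_nat// ltW.
have Npow : N%:R = N%:R `^ (2 - p) * N%:R `^ (p - 1) :> R.
  rewrite -powRD ?(gt_eqF NR0) ?implybT//.
  by rewrite (_ : 2 - p + (p - 1) = 1) ?powRr1//; ring.
have Np0 : 0 < N%:R `^ (p - 1) :> R by rewrite powR_gt0.
have := le_trans le_n le_N.
rewrite [X in kappa * X]Npow mulrA -[leRHS]mul1r ler_pM2r//.
move: Nlarge; rewrite ler_pdivrMr// mulrC; lra.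
Qed.

(** A rational number is at distance 0 from a fraction, which the positive lower
    bound excludes.  Types are positive by definition, which matters when
    p = 2: only the exponents p - 2 + e with e > 0 are types, and the infimum
    is taken over them. *)
Lemma min_type_le rho p kappa : 0 < kappa -> 2 <= p ->
  approximation_exponent rho p kappa -> (min_type rho <= (p - 2)%:E)%E.
Proof.
move=> kappa0 p2 approx; rewrite /min_type; case: ifPn => [/asboolP[q rhoE]|_].
  exfalso; have := approx (numq q) (denq q) (denq_neq0 q).
  rewrite -[q in ratr q]divq_num_den in rhoE.
  rewrite rhoE fmorph_div/= !ratr_int subrr normr0.
  by apply/negP; rewrite -ltNge mulr_gt0// powR_gt0// normr_gt0 intr_eq0 denq_neq0.
apply/lee_addgt0Pr => e e0; apply: ereal_inf_lbound.
exists (p - 2 + e) => //; split; first by lra.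
exists kappa => // m n n0; apply: le_trans (approx m n n0).
apply: ler_wpM2l; first exact: ltW.
apply: ler_powR; last by lra.
by rewrite -intr_norm ler1z -gtz0_ge1 normr_gt0.
Qed.

End diophantine.

(** * The resonance function near its zeros *)

Section resonance_function.
Context {R : realType}.
Variables (alpha lam s : R).
Hypotheses (alpha_gt0 : 0 < alpha) (alpha_lt1 : alpha < 1) (lam_ge1 : 1 <= lam).
Implicit Types (m n : int).

Local Notation rho := (c1 alpha).
Local Notation radius := ((rho - 1) / 2).

Let lam_gt0 : 0 < lam. Proof. exact: lt_le_trans lam_ge1. Qed.

Let ialpha_gt1 : 1 < alpha^-1.
Proof. by rewrite invf_gt1. Qed.

Lemma c1_gt1 : 1 < rho.
Proof.
suff : 3 < Num.sqrt (- 3 + 12 * alpha^-1) by rewrite /c1; lra.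
rewrite -[ltLHS](_ : Num.sqrt (3 ^+ 2) = 3); last by rewrite sqrtr_sqr gtr0_norm.
by rewrite ltr_sqrt; move: ialpha_gt1; lra.
Qed.

(** The parameter c1 is a zero of the resonance function along xi1 = c1 xi. *)
Lemma c1_root : alpha * (1 - 3 * rho + 3 * rho ^+ 2) = 1.
Proof.
rewrite /c1; set r := Num.sqrt _.
have r2 : r ^+ 2 = - 3 + 12 * alpha^-1.
  by rewrite sqr_sqrtr//; move: ialpha_gt1; lra.
have -> : 1 - 3 * (2^-1 + r / 6) + 3 * (2^-1 + r / 6) ^+ 2 =
  (3 + r ^+ 2) / 12 by field.
by rewrite r2; field; rewrite gt_eqF.
Qed.

Lemma resonanceE m n : n != 0 ->
  resonance alpha lam m (n - m) =
  - (3 * alpha) * xi lam n ^+ 3 *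
    ((m%:~R / n%:~R - rho) * (m%:~R / n%:~R - 1 + rho)).
Proof.
move=> n0; have nR : n%:~R != 0 :> R by rewrite intr_eq0.
have lam0 : lam != 0 by rewrite gt_eqF.
rewrite /resonance [m + _]addrC subrK /xi intrB.
have root := c1_root.
set c := m%:~R / n%:~R.
transitivity ((n%:~R / lam) ^+ 3 *
    (alpha * (1 - 3 * rho + 3 * rho ^+ 2) - alpha * (1 - 3 * c + 3 * c ^+ 2))).
  by rewrite root /c; field; rewrite nR lam0.
by ring.
Qed.

(** The second zero 1 - c1 is negative, so near c1 its factor is bounded by a
    constant and only the distance to c1 counts. *)
Lemma norm_resonance_le m n : n != 0 ->
  `|m%:~R / n%:~R - rho| <= radius ->
  `|resonance alpha lam m (n - m)| <=
  9 * rho * `|xi lam n| ^+ 3 * `|m%:~R / n%:~R - rho|.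
Proof.
move=> n0 near; have normE (a x d e : R) : 0 <= a ->
    `|- a * x ^+ 3 * (d * e)| = a * `|x| ^+ 3 * (`|d| * `|e|).
  by move=> a0; rewrite [LHS]normrM normrM normrN normrX (normrM d) (ger0_norm a0).
rewrite resonanceE// normE ?mulr_ge0 ?(ltW alpha_gt0)//.
have rho1 := c1_gt1.
have far : `|m%:~R / n%:~R - 1 + rho| <= 3 * rho.
  move: near; rewrite ler_norml => /andP[? ?].
  by rewrite ler_norml; apply/andP; split; lra.
have xi3 : 0 <= `|xi lam n| ^+ 3 by rewrite exprn_ge0.
have d0 := normr_ge0 (m%:~R / n%:~R - rho).
apply: (@le_trans _ _ (3 * 1 * `|xi lam n| ^+ 3 *
  (`|m%:~R / n%:~R - rho| * (3 * rho)))); last first.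
  by rewrite le_eqVlt; apply/orP; left; apply/eqP; ring.
apply: ler_pM; rewrite ?mulr_ge0// ?(ltW alpha_gt0)//.
  by apply: ler_wpM2r => //; rewrite ler_pM2l// ltW.
exact: ler_wpM2l.
Qed.

(** As c1 > 1, near c1 both m/n and 1 - m/n are bounded and bounded away from 0,
    so the three frequencies carry comparable weights.  The bound is squared to
    remove the root of <H>. *)
Lemma resonance_bound_near_c1 K : 0 <= K -> resonance_bound alpha lam s K ->
  exists2 B : R, 0 < B & forall m n, n != 0 ->
    `|m%:~R / n%:~R - rho| <= radius ->
    bracket (xi lam n) `^ (2 - 2 * s) <=
    B * (1 + `|xi lam n| ^+ 3 * `|m%:~R / n%:~R - rho|).
Proof.
move=> K0 bound; have rho1 := c1_gt1.
(* One constant controls both ratios: |m/n| and |1 - m/n| lie in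
   [radius, 2 c1]. *)
pose D := 2 * rho + radius^-1.
have radius0 : 0 < radius by rewrite divr_gt0 ?subr_gt0.
have D_ge : 2 * rho <= D by rewrite lerDl invr_ge0 ltW.
have D1 : 1 <= D by lra.
have Dradius : 1 <= D * radius.
  rewrite /D mulrDl mulVf ?gt_eqF// lerDr.
  by rewrite !mulr_ge0 ?invr_ge0// ?subr_ge0; lra.
pose L := 2 * lam * (K * (D `^ `|s| * D `^ `|s|)).
have L0 : 0 <= L by rewrite !mulr_ge0 ?powR_ge0 ?(ltW lam_gt0).
exists (L ^+ 2 * (9 * rho) + 1) => [|m n n0 near].
  by rewrite ltr_pwDr// mulr_ge0 ?exprn_ge0//; lra.
have nR : n%:~R != 0 :> R by rewrite intr_eq0.
set c := m%:~R / n%:~R in near *.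
have xi1 : xi lam m = c * xi lam n.
  by rewrite /xi /c; field; rewrite nR gt_eqF.
have xi2 : xi lam (n - m) = (1 - c) * xi lam n.
  by rewrite /xi /c intrB; field; rewrite nR gt_eqF.
have /andP[near1 near2] : - radius <= c - rho <= radius by rewrite -ler_norml.
have xi_ge : bracket (xi lam n) <= 2 * lam * `|xi lam n|.
  rewrite /bracket /xi normf_div (gtr0_norm lam_gt0).
  have n1 : 1 <= `|n%:~R| :> R by rewrite -intr_norm ler1z -gtz0_ge1 normr_gt0.
  have -> : 2 * lam * (`|n%:~R| / lam) = `|n%:~R| + `|n%:~R| :> R.
    by field; rewrite gt_eqF.
  by apply: lerD => //; rewrite ler_pdivrMr// ler_peMr.
set z := bracket (xi lam n) in xi_ge *.
have z0 : 0 < z by exact: bracket_gt0.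
set H := bracket (resonance alpha lam m (n - m)).
have H0 : 0 < H by exact: bracket_gt0.
have step : z `^ (1 - s) <= L * H `^ 2^-1.
  have := bound m (n - m); rewrite [m + _]addrC subrK -/z -/H => le_H.
  have le1 : bracket (xi lam m) `^ s <= D `^ `|s| * z `^ s.
    rewrite xi1; apply: le_bracket_powR_scale => //.
      by rewrite ger0_norm; lra.
    apply: le_trans Dradius _; rewrite ler_pM2l ?ger0_norm //; lra.
  have le2 : bracket (xi lam (n - m)) `^ s <= D `^ `|s| * z `^ s.
    rewrite xi2; apply: le_bracket_powR_scale => //.
      by rewrite ler0_norm; lra.
    by apply: le_trans Dradius _; rewrite ler_pM2l ?ler0_norm //; lra.
  have zs0 : 0 < z `^ s by rewrite powR_gt0.
  have zpow : z = z `^ (1 - s) * z `^ s.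
    by rewrite -powRD ?subrK ?powRr1 ?(ltW z0)// (gt_eqF z0) implybT.
  rewrite -(ler_pM2r zs0) -(ler_pM2r zs0) -zpow.
  apply: le_trans (ler_wpM2r (ltW zs0) xi_ge) _.
  rewrite -[leLHS]mulrA.
  apply: le_trans (ler_wpM2l _ le_H) _; first by rewrite mulr_ge0// ltW.
  have -> : L * H `^ 2^-1 * z `^ s * z `^ s = 2 * lam *
      (K * ((D `^ `|s| * z `^ s) * (D `^ `|s| * z `^ s)) * H `^ 2^-1).
    by rewrite /L; ring.
  apply: ler_wpM2l; first by rewrite mulr_ge0// ltW.
  apply: ler_wpM2r; first exact: powR_ge0.
  by apply: ler_wpM2l => //; apply: ler_pM => //; exact: powR_ge0.
have -> : z `^ (2 - 2 * s) = (z `^ (1 - s)) ^+ 2.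
  by rewrite -powR_mulrn ?powR_ge0// -powRrM; congr (_ `^ _); ring.
have H2 : (H `^ 2^-1) ^+ 2 = H.
  by rewrite -powR_mulrn ?powR_ge0// -powRrM mulVf// powRr1 ?ltW.
apply: (@le_trans _ _ (L ^+ 2 * H)).
  rewrite -[X in L ^+ 2 * X]H2 -exprMn ler_pXn2r//.
    by rewrite nnegrE powR_ge0.
  by rewrite nnegrE mulr_ge0 ?powR_ge0.
have := norm_resonance_le m n n0 near; rewrite -/c => H_le.
have L2 : 0 <= L ^+ 2 by rewrite exprn_ge0.
set d := `|xi lam n| ^+ 3 * `|c - rho|.
have d0 : 0 <= d by rewrite mulr_ge0 ?exprn_ge0.
have {}H_le : H <= 9 * rho * (1 + d).
  rewrite /H /bracket mulrDr mulr1 mulrA; apply: lerD => //; lra.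
apply: le_trans (ler_wpM2l L2 H_le) _.
rewrite [leLHS]mulrA; apply: ler_wpM2r; first by rewrite addr_ge0.
by rewrite lerDl.
Qed.

(** The bound near c1 is informative only for large denominators.  Applying it
    to the unreduced fraction (N m)/(N n), with a fixed large N, makes it
    informative for every m/n at the price of a power of N. *)
Lemma resonance_bound_approximation_exponent K sigma :
  0 <= K -> resonance_bound alpha lam s K -> s <= sigma -> 0 <= sigma < 1 ->
  exists2 kappa, 0 < kappa &
    approximation_exponent rho (1 + 2 * sigma) kappa.
Proof.
move=> K0 bound s_sigma /andP[sigma0 sigma1].
have [B B0 near_c1] := resonance_bound_near_c1 K K0 bound.
have rho1 := c1_gt1.
have radius0 : 0 < radius by rewrite divr_gt0 ?subr_gt0.
have exp0 : 0 < 2 - 2 * sigma by lra.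
(* N is such that <N n / lam>^(2 - 2 sigma) >= 2 B, so that the term 1 of
   the bound near c1 is absorbed. *)
have [N N0 N_large] := exists_nat_powR_ge (2 - 2 * sigma)
  (2 * B * lam `^ (2 - 2 * sigma)) exp0.
have NR1 : 1 <= N%:R :> R by rewrite ler1n.
pose p := 1 + 2 * sigma.
pose kappa := (2 * B)^-1 * (2 * N%:R) `^ (- p).
(* Fractions that are not near c1 are handled by radius, as |n| >= 1. *)
exists (Num.min kappa radius).
  rewrite lt_min radius0 andbT mulr_gt0 ?invr_gt0 ?powR_gt0 ?mulr_gt0//.
  by rewrite ltr0n.
move=> m n n0; rewrite distrC.
have n1 : 1 <= `|n%:~R| :> R by rewrite -intr_norm ler1z -gtz0_ge1 normr_gt0.
have n_pos : 0 < `|n%:~R| :> R by exact: lt_le_trans n1.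
have [near|far] := leP `|m%:~R / n%:~R - rho| radius; last first.
  apply: le_trans (ltW far); rewrite -[leRHS]mulr1.
  apply: ler_pM; rewrite ?powR_ge0 ?ge_min ?lexx ?orbT//.
    by rewrite le_min !ltW// mulr_gt0 ?invr_gt0 ?powR_gt0 ?mulr_gt0 ?ltr0n.
  rewrite powRN invf_le1 ?powR_gt0// -[leLHS](powRr0 `|n%:~R|).
  by apply: ler_powR => //; lra.
have Nn0 : N%:Z * n != 0 by rewrite mulf_neq0// eqz_nat -lt0n.
have fracE : (N%:Z * m)%:~R / (N%:Z * n)%:~R = m%:~R / n%:~R :> R.
  rewrite !intrM -mulf_div divff ?mul1r// -pmulrn gt_eqF//.
  exact: lt_le_trans NR1.
have := near_c1 (N%:Z * m) _ Nn0; rewrite fracE => /(_ near).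
set d := `|_ - rho|; set x := `|xi lam _|.
have xE : x = N%:R * `|n%:~R| / lam.
  by rewrite /x /xi intrM normf_div normrM -pmulrn normr_nat (gtr0_norm lam_gt0).
set z := bracket _; have zE : z = 1 + x by [].
have z1 : 1 <= z := bracket_ge1 _; have z0 : 0 < z := bracket_gt0 _.
have x0 : 0 <= x := normr_ge0 _.
have d0 : 0 <= d := normr_ge0 _.
move=> upper.
have {upper}upper : z `^ (2 - 2 * sigma) <= B * (1 + x ^+ 3 * d).
  by apply: le_trans upper; apply: ler_powR => //; lra.
have z_large : 2 * B <= z `^ (2 - 2 * sigma).
  have le_z : N%:R / lam <= z.
    rewrite zE xE; apply: (@le_trans _ _ (N%:R * `|n%:~R| / lam)).
      by rewrite ler_pM2r ?invr_gt0// ler_peMr.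
    by rewrite lerDr.
  rewrite -(ler_pM2r (powR_gt0 (2 - 2 * sigma) lam_gt0)).
  apply: le_trans N_large _; rewrite -powRM ?(ltW z0) ?(ltW lam_gt0)//.
  apply: ge0_ler_powR; rewrite ?nnegrE ?mulr_ge0 ?(ltW z0) ?(ltW lam_gt0)//.
    exact: ltW.
  by rewrite -ler_pdivrMr.
have {}upper : z `^ (2 - 2 * sigma) <= 2 * B * (z ^+ 3 * d).
  have : x ^+ 3 * d <= z ^+ 3 * d.
    by apply: ler_wpM2r => //; rewrite ler_pXn2r ?nnegrE ?(ltW z0)// zE lerDr.
  move=> /(ler_wpM2l (ltW B0)); lra.
have {upper}lower : (2 * B)^-1 * z `^ (- p) <= d.
  rewrite mulrC ler_pdivrMr ?mulr_gt0//.
  have z3 : 0 < z ^+ 3 by rewrite exprn_gt0.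
  rewrite -(ler_pM2r z3); apply: le_trans (_ : z `^ (2 - 2 * sigma) <= _).
    rewrite -powR_mulrn ?(ltW z0)// -powRD ?(gt_eqF z0) ?implybT//.
    by rewrite le_eqVlt; apply/orP; left; apply/eqP; congr (_ `^ _); rewrite /p; ring.
  by apply: le_trans upper _; rewrite le_eqVlt; apply/orP; left; apply/eqP; ring.
apply: le_trans lower.
apply: (@le_trans _ _ (kappa * `|n%:~R| `^ (- p))).
  by apply: ler_wpM2r; rewrite ?powR_ge0// ge_min lexx.
rewrite /kappa -mulrA; apply: ler_wpM2l; first by rewrite invr_ge0 mulr_ge0// ltW.
rewrite -powRM ?(ltW n_pos) ?mulr_ge0//.
rewrite !powRN lef_pV2 ?posrE ?powR_gt0 ?mulr_gt0 ?ltr0n//.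
apply: ge0_ler_powR; rewrite ?nnegrE ?mulr_ge0 ?(ltW z0) ?(ltW n_pos)//.
  by rewrite /p; lra.
have Nn1 : 1 <= N%:R * `|n%:~R| :> R by rewrite -[leLHS]mulr1; apply: ler_pM.
have : N%:R * `|n%:~R| / lam <= N%:R * `|n%:~R| :> R.
  by rewrite ler_pdivrMr// ler_peMr// (le_trans ler01).
by rewrite zE xE; lra.
Qed.

Lemma resonance_bound_false K : 0 <= K -> resonance_bound alpha lam s K ->
  (s%:E < Order.min 1 ((2^-1)%:E + (2^-1)%:E * min_type rho))%E -> False.
Proof.
move=> K0 bound; rewrite lt_min => /andP[]; rewrite lte_fin => s1 s_type.
(* For s < 0 the exponent 1 + 2 s would be less than 1, too small for the
   comparison with Dirichlet's theorem. *)
pose sigma := Num.max s 0.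
have sigma_itv : 0 <= sigma < 1 by rewrite le_max lexx orbT gt_max s1 ltr01.
have s_sigma : s <= sigma by rewrite le_max lexx.
have [kappa kappa0 approx] :=
  resonance_bound_approximation_exponent K sigma K0 bound s_sigma sigma_itv.
have /andP[sigma0 _] := sigma_itv.
have sigma_ge : 2 <= 1 + 2 * sigma.
  by apply: approximation_exponent_ge2 kappa0 _ approx; lra.
have sE : sigma = s.
  by move: sigma_ge; rewrite /sigma; case: (leP s 0) => //; lra.
have := min_type_le _ _ _ kappa0 sigma_ge approx.
rewrite sE => type_le.
have : ((2^-1)%:E * min_type rho <= (2^-1)%:E * (1 + 2 * s - 2)%:E)%E.
  by apply: lee_wpmul2l; rewrite ?lee_fin.
move=> /(leeD2l (2^-1)%:E)/(lt_le_trans s_type).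
rewrite -EFinM -EFinD lte_fin; lra.
Qed.

End resonance_function.

(** * Failure of the bilinear estimates *)

Theorem proposition3p9 (R : realType) (alpha lam s : R) :
  0 < alpha < 1 -> 1 <= lam ->
  (s%:E < Order.min 1 ((2^-1)%:E + (2^-1)%:E * min_type (c1 alpha)))%E ->
  (forall b : R,
     ~ bilinear_estimate lam (Xalpha_space alpha lam s b)
         (X_norm lam s (b - 1)) (Xalpha_norm alpha lam s b)) /\
  ~ bilinear_estimate lam (Y_space alpha lam s)
      (Z_norm lam s) (Y_norm alpha lam s).
Proof.
move=> /andP[alpha0 alpha1] lam1 s_lt.
have lam0 : 0 < lam by exact: lt_le_trans lam1.
split=> [b /(X_estimate_resonance _ _ _ lam0)|/(YZ_estimate_resonance _ _ _ lam0)].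
  by move=> [K K0 bound]; exact: (resonance_bound_false _ _ _ alpha0 alpha1 lam1 K).
by move=> [K K0 bound]; exact: (resonance_bound_false _ _ _ alpha0 alpha1 lam1 K).
Qed.
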